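(* There exists an absolute constant $C>0$ such that the following holds. Let $n\geq 1$ be an integer, let $\alpha\in(0,1)$, and let $f=D_n-g$, where $g$ is a $\{0,1\}$-cosine polynomial with $\deg(g)\leq n^{1-\alpha}$. If $I\subseteq[C(\alpha n)^{-1},\pi]$ is an interval, then \[ Z_I(f)\leq C\alpha^{-1}(n|I|+1). \]
   Context: $D_n(x)=\sum_{k=0}^n\cos(kx)$. A $\{0,1\}$-cosine polynomial is a function of the form $g(x)=\sum_{k=0}^{m}\epsilon_k\cos(kx)$ with all $\epsilon_k\in\{0,1\}$; its degree $\deg(g)$ is the largest $k$ with $\epsilon_k=1$ (and $0$ for the zero polynomial). $|I|$ is the length of $I$, and $Z_I(f)$ is the number of zeros of $f$ in $I$, i.e. $|\{x\in I:f(x)=0\}|$. *)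

(* Defs.v *)
From mathcomp Require Import all_boot all_order all_algebra.
From mathcomp Require Import all_classical all_reals all_analysis.

Set Implicit Arguments.
Unset Strict Implicit.
Unset Printing Implicit Defensive.

Import Order.TTheory GRing.Theory Num.Theory.
Import numFieldNormedType.Exports.

Local Open Scope classical_set_scope.
Local Open Scope ring_scope.

Definition dirichlet_cos (R : realType) (n : nat) (x : R) : R :=
  \sum_(0 <= k < n.+1) cos (k%:R * x).

Definition cos_poly01 (R : realType) (m : nat) (eps : 'I_m.+1 -> bool)
    (x : R) : R :=
  \sum_(k < m.+1) (eps k)%:R * cos (k%:R * x).

(* The functions cos (k x) are linearly independent, so the degree is
   determined by the function [cos_poly01 eps]; it is 0 if no [eps k] holds. *)
Definition cos_deg (m : nat) (eps : 'I_m.+1 -> bool) : nat :=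
  (\max_(k < m.+1 | eps k) k)%N.

(* [counting] takes the value +oo on infinite sets. *)
Definition num_zeros (R : realType) (I : set R) (f : R -> R) : \bar R :=
  counting [set x | I x /\ f x = 0].

(* Main.v *)
Require Import Defs.
From mathcomp Require Import all_boot all_order all_algebra.
From mathcomp Require Import all_classical all_reals all_analysis.
From mathcomp Require Import ring lra.

Set Implicit Arguments.
Unset Strict Implicit.
Unset Printing Implicit Defensive.

Import Order.TTheory GRing.Theory Num.Theory.
Import numFieldNormedType.Exports.

Local Open Scope classical_set_scope.
Local Open Scope ring_scope.

(** Multiplying [f = D_n - g] by [2 sin (x/2)] loses no zero and turns it into
    [F x = sin ((n + 1/2) x) + h x], where [h] is a sum of at most [2 d + 3]
    sinusoids of frequency at most [d + 1/2], with [d = deg g].  Since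
    [d <= n^(1 - alpha)], the ratio of the frequencies [d + 1/2] and [n + 1/2]
    is at most [n^(- alpha/2)] ([freq_ratio_le]), so each differentiation makes
    [h] smaller relative to the leading sinusoid by that factor.  After
    [J ~ 10 / alpha] derivatives the gain is [n^-5], which beats the trivial
    bound [2 d + 3] on the size of [h] when [n >= 2] ([low_part_small]): from
    then on the derivatives of [F] are those of [sin ((n + 1/2) x)] up to a relative error
    of one quarter.

    If [F] had [J + 2] zeros in a window shorter than [1 / (2 n + 1)], then by
    Rolle the derivatives of order [J] and [J + 1] would both vanish in that
    window, so that the sine and the cosine of nearly the same angle would both
    be small, against [sin^2 + cos^2 = 1] ([perturbed_sin_zeros_spread]).
    Hence any [J + 2] consecutive zeros span at least [1 / (2 n + 1)], and
    cutting the sorted list of the zeros in [I] into blocks of length [J + 1]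
    gives at most [(J + 1) ((2 n + 1) |I| + 1)] of them ([size_sparse]), which
    is [O(alpha^-1 (n |I| + 1))]. *)

(** * Iterated Rolle *)

(** The zeros of the derivative are returned in increasing order, and to the
    right of [x], so that the lemma can be applied again to them. *)
Lemma rolle_interlacing (R : realType) (f df : R -> R) (x : R) (s : seq R) :
  (forall y : R, is_derive y 1 f (df y)) ->
  path <%R x s -> (forall y, y \in x :: s -> f y = 0) ->
  exists t : seq R, [/\ size t = size s, path <%R x t,
    (forall y, y \in t -> y <= last x s) & forall y, y \in t -> df y = 0].
Proof.
move=> fdf; elim: s x => [|y s IH] x; first by move=> _ _; exists [::].
move=> /= /andP[xy ys] f0.
have [|t [tsize yt t_last df0]] := IH y ys.
  by move=> z zs; apply: f0; rewrite inE zs orbT.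
have fcont : {within `[x, y], continuous f}.
  apply: continuous_subspaceT => z; apply: differentiable_continuous.
  by apply/derivable1_diffP; have [] := fdf z.
have fxy : f x = f y by rewrite !f0 ?inE ?eqxx ?orbT.
have [|c + c0] := Rolle xy _ fcont fxy; first by move=> z _; have [] := fdf z.
rewrite in_itv /= => /andP[xc cy].
have dfc : df c = 0.
  by have [_ <-] := fdf c; have [_] := c0.
exists (c :: t); split => /=.
- by rewrite tsize.
- rewrite xc /=; apply: path_le yt; first exact: lt_trans.
  exact: cy.
- move=> z; rewrite inE => /predU1P[->|/t_last//].
  apply: (le_trans (ltW cy)); move: ys; clear; elim: s y => //= z s IH y.
  by move=> /andP[yz zs]; rewrite (le_trans (ltW yz)) ?IH.
- by move=> z; rewrite inE => /predU1P[->|/df0].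
Qed.

Lemma iterated_rolle (R : realType) (F : nat -> R -> R) (x : R) (s : seq R) :
  (forall j (y : R), is_derive y 1 (F j) (F j.+1 y)) ->
  path <%R x s -> (forall y, y \in x :: s -> F 0 y = 0) ->
  exists2 c, x <= c <= last x s & F (size s) c = 0.
Proof.
have [k] := ubnP (size s); elim: k => // k IH in F x s *.
case: s => [_ _ _ F0|y s].
  by exists x; rewrite ?lexx // F0 ?inE.
rewrite [size _]/= ltnS => sk dF xs F0.
have [t [tsize xt t_last dF0]] := rolle_interlacing (dF 0%N) xs F0.
case: t tsize xt t_last dF0 => [//|z t] /= [tsize] /andP[xz zt] t_last dF0.
have [|c] := IH (fun j => F j.+1) z t _ (fun j => dF j.+1) zt dF0.
  by rewrite tsize.
move=> /andP[zc ct] Fc; exists c; last by rewrite -tsize.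
rewrite (le_trans (ltW xz) zc) /= (le_trans ct)//.
by apply: t_last; rewrite mem_last.
Qed.

(** * Counting points of which no short window contains many *)

(** Walking along the increasing list in steps of [K], each complete step moves
    by at least [delta]; the last block of at most [K] points, which need not
    spread at all, accounts for the summand [1]. *)
Lemma size_sparse (R : realType) (P : R -> Prop) (K : nat) (delta : R) :
  (0 < K)%N -> 0 < delta ->
  (forall x t, path <%R x t -> (forall y, y \in x :: t -> P y) ->
    size t = K -> delta <= last x t - x) ->
  forall x s, path <%R x s -> (forall y, y \in x :: s -> P y) ->
  (size s).+1%:R <= K%:R * ((last x s - x) / delta + 1).
Proof.
move=> K0 d0 sparse x s; have [k] := ubnP (size s).
elim: k => // k IH in x s *; rewrite ltnS => sk xs sP.
have [sK|Ks] := ltnP (size s) K.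
  apply: (@le_trans _ _ K%:R); first by rewrite ler_nat.
  rewrite ler_peMr// lerDr divr_ge0 ?(ltW d0)// subr_ge0.
  have : last x s \in x :: s by rewrite mem_last.
  rewrite inE => /predU1P[->//|].
  by move/(order_path_min lt_trans)/allP: xs => + ls => /(_ _ ls)/ltW.
rewrite -[s](cat_take_drop K) last_cat.
move: xs; rewrite -{1}[s](cat_take_drop K) cat_path => /andP[xt x's'].
have tK : size (take K s) = K by rewrite size_take_min; apply/minn_idPl.
have window := sparse _ _ xt _ tK.
have {}window : delta <= last x (take K s) - x.
  apply: window => y; rewrite inE => /predU1P[->|yt]; apply: sP.
    by rewrite inE eqxx.
  by rewrite inE (mem_take yt) orbT.
have IHs' := IH (last x (take K s)) (drop K s) _ x's' _.
have {}IHs' : (size (drop K s)).+1%:R <= K%:R *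
    ((last (last x (take K s)) (drop K s) - last x (take K s)) / delta + 1).
  apply: IHs' => [|y].
    rewrite size_drop; apply: leq_trans sk; rewrite ltn_subrL K0 /=.
    exact: leq_trans Ks.
  rewrite inE => /predU1P[->|yt]; apply: sP.
    have := mem_last x (take K s); rewrite !inE => /predU1P[->|/mem_take ->].
      by rewrite eqxx.
    by rewrite orbT.
  by rewrite inE (mem_drop yt) orbT.
(* The block just removed contributes [K] to both sides. *)
rewrite size_cat tK -addnS natrD.
apply: (le_trans (lerD (lexx _) IHs')).
rewrite -{1}[K%:R]mulr1 -mulrDr ler_wpM2l//.
rewrite addrA lerD2r -[X in X + _](divff (lt0r_neq0 d0)) -mulrDl.
by rewrite ler_pM2r ?invr_gt0//; lra.
Qed.

(** Bounding finite lists also excludes infinite sets, whose counting measure is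
    infinite, because such sets contain arbitrarily long lists. *)
Lemma counting_le (R : realType) (T : choiceType) (A : set T) (b : R) :
  (forall s : seq T, uniq s -> (forall y, y \in s -> A y) ->
    (size s)%:R <= b) ->
  (counting A <= b%:E)%E.
Proof.
move=> Ab; rewrite /counting; case: asboolP => Afin.
  rewrite lee_fin; apply: Ab; first exact: finmap.fset_uniq.
  by move=> y; rewrite in_fset_set// inE.
have [B BA bB] := infinite_set_fset (Num.truncn b).+1 Afin.
have := Ab _ (finmap.fset_uniq B) BA.
move=> /le_lt_trans/(_ (truncnS_gt b)); rewrite ltr_nat => /(leq_trans bB).
by rewrite ltnn.
Qed.

Lemma lebesgue_measure_itv_ge (R : realType) (I : interval R) (x y : R) :
  [set` I] x -> [set` I] y -> ((y - x)%:E <= lebesgue_measure [set` I])%E.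
Proof.
move=> Ix Iy; have [xy|yx] := leP x y; last first.
  by rewrite (@le_trans _ _ 0%E)// lee_fin subr_le0 ltW.
have -> : (y - x)%:E = lebesgue_measure (`[x, y]%classic : set R).
  rewrite lebesgue_measure_itv /= lte_fin EFinN -EFinD.
  by case: ltgtP xy => // -> _; rewrite subrr.
apply: le_measure; rewrite ?inE; try exact: measurable_itv.
move=> z /=; rewrite in_itv /= => /andP[xz zy].
have /= := @interval_is_interval _ I x y Ix Iy z.
by rewrite xz zy; apply.
Qed.

(** * Derivatives of sinusoids *)

(** The [j]-th derivative of [x |-> sin (w * x)]; the quarter-turn phase shift
    avoids a case distinction on [j] modulo 4. *)
Definition sin_deriv (R : realType) (w : R) (j : nat) (x : R) : R :=
  w ^+ j * sin (w * x + j%:R * (pi / 2)).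

Lemma sin_deriv0 (R : realType) (w x : R) : sin_deriv w 0 x = sin (w * x).
Proof. by rewrite /sin_deriv expr0 mul1r mul0r addr0. Qed.

Lemma is_derive_sin_deriv (R : realType) (w : R) (j : nat) (x : R) :
  is_derive x 1 (sin_deriv w j) (sin_deriv w j.+1 x).
Proof.
rewrite /sin_deriv.
have dphase : is_derive x 1 (fun y : R => w * y + j%:R * (pi / 2)) w.
  apply: is_derive_eq.
  by rewrite addr0 -[_%:A]/(w * 1) mulr1.
have dsin := @is_derive1_comp _ sin (fun y => w * y + j%:R * (pi / 2)) x _ _
  (is_derive_sin _) dphase.
have := @is_deriveZ _ _ _ _ (w ^+ j) x 1 _ dsin.
rewrite (_ : w ^+ j *: _ = w ^+ j.+1 * sin (w * x + j.+1%:R * (pi / 2))) //.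
rewrite -[j.+1%:R]natr1 [(_ + 1) * _]mulrDl mul1r addrA sinDpihalf exprSr.
by rewrite -[_ *: _]/(_ * (_ * _)); ring.
Qed.

Lemma sin_deriv_le (R : realType) (w v : R) (j : nat) (x : R) :
  `|w| <= v -> `|sin_deriv w j x| <= v ^+ j.
Proof.
move=> wv; rewrite normrM normrX -[leRHS]mulr1.
rewrite ler_pM ?exprn_ge0// ?sin_max//.
  by rewrite lerXn2r ?nnegrE// (le_trans _ wv).
Qed.

Lemma sin_lipschitz (R : realType) (x y : R) : `|sin x - sin y| <= `|x - y|.
Proof.
wlog xy : x y / y <= x.
  by move=> H; have [/H//|/ltW/H] := leP y x; rewrite distrC [leRHS]distrC.
have [|z _ ->] := @MVT_segment _ sin cos _ _ xy.
  by apply: continuous_subspaceT => z; exact: continuous_sin.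
by rewrite normrM ler_piMl// cos_max.
Qed.

(** * Zeros of a perturbed sinusoid *)

(** Here [h j] is the [j]-th derivative of the perturbation.  If the [J + 2]
    zeros were closer, Rolle would give zeros of the derivatives of order [J]
    and [J + 1]; there the sine, respectively the cosine, of the phase is at
    most [1/4] in absolute value.  The two phases differ by at most [1/2], so
    the sine is at most [3/4] at the second point too, and
    [(1/4)^2 + (3/4)^2 < 1]. *)
Lemma perturbed_sin_zeros_spread (R : realType) (w : R) (h : nat -> R -> R)
    (J : nat) (x : R) (s : seq R) :
  0 < w ->
  (forall j (y : R), is_derive y 1 (h j) (h j.+1 y)) ->
  (forall j y, (J <= j)%N -> `|h j y| <= w ^+ j / 4) ->
  path <%R x s -> (forall y, y \in x :: s -> sin (w * y) + h 0 y = 0) ->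
  size s = J.+1 ->
  (2 * w)^-1 <= last x s - x.
Proof.
move=> w0 dh hle xs s0 sJ.
pose F j y := sin_deriv w j y + h j y.
have dF j (y : R) : is_derive y 1 (F j) (F j.+1 y).
  have := is_deriveD (is_derive_sin_deriv w j y) (dh j y).
  by rewrite /F.
have F0 y : y \in x :: s -> F 0 y = 0.
  by move=> /s0; rewrite /F sin_deriv0.
have small j c : (J <= j)%N -> F j c = 0 ->
    `|sin (w * c + j%:R * (pi / 2))| <= 1 / 4.
  move=> Jj /eqP; rewrite /F addr_eq0 => /eqP Fc.
  have := hle j c Jj; rewrite -normrN -Fc /sin_deriv normrM normrX gtr0_norm//.
  by rewrite mul1r ler_pM2l// exprn_gt0.
have [c /andP[xc cl] Fc] := iterated_rolle dF xs F0.
(* Dropping the last point leaves [J + 1] zeros, the number for order [J]. *)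
have [c' /andP[xc' cl'] Fc'] : exists2 c, x <= c <= last x s & F J c = 0.
  case: (lastP s) sJ xs F0 => // s' z; rewrite size_rcons => -[<-].
  rewrite rcons_path last_rcons => /andP[xs' lz] F0.
  have [|c2 /andP[xc2 cl2] Fc2] := iterated_rolle dF xs'.
    by move=> y ys'; apply: F0; rewrite -rcons_cons mem_rcons inE ys' orbT.
  by exists c2; rewrite // xc2 (le_trans cl2) ?ltW.
rewrite leNgt; apply/negP => short.
have sinc' := small _ _ (leqnn J) Fc'.
have cosc : `|cos (w * c + J%:R * (pi / 2))| <= 1 / 4.
  have := small J.+1 c (leqnSn J); rewrite -sJ => /(_ Fc).
  by rewrite sJ -[J.+1%:R]natr1 [(_ + 1) * _]mulrDl mul1r addrA sinDpihalf.
have close : `|w * c - w * c'| <= 1 / 2.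
  rewrite -mulrBr normrM gtr0_norm//.
  have -> : 1 / 2 = w * (2 * w)^-1 by field; rewrite gt_eqF.
  rewrite ler_pM2l//; apply: ltW; apply: le_lt_trans short.
  by rewrite ler_norml; apply/andP; split; lra.
have sinc : `|sin (w * c + J%:R * (pi / 2))| <= 3 / 4.
  have := sin_lipschitz (w * c + J%:R * (pi / 2)) (w * c' + J%:R * (pi / 2)).
  rewrite (_ : _ + _ - (_ + _) = w * c - w * c'); last by ring.
  move=> /le_trans/(_ close); rewrite !ler_norml in sinc' *.
  move=> /andP[h1 h2]; move/andP: sinc' => [h3 h4].
  by apply/andP; split; lra.
have := cos2Dsin2 (w * c + J%:R * (pi / 2)).
move: cosc sinc; set C := cos _; set S := sin _.
rewrite !ler_norml => /andP[h1 h2] /andP[h3 h4]; nra.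
Qed.

(** * The cosine polynomials *)

Lemma mul_2sin_half_cos (R : realType) (k : nat) (x : R) :
  2 * sin (x / 2) * cos (k%:R * x) =
  sin ((k%:R + 1 / 2) * x) - sin ((k%:R - 1 / 2) * x).
Proof.
rewrite mulrBl !mulrDl (_ : 1 / 2 * x = x / 2); last by ring.
by rewrite sinD sinB; ring.
Qed.

Lemma dirichlet_cos_closed (R : realType) (n : nat) (x : R) :
  2 * sin (x / 2) * dirichlet_cos n x =
  sin ((n%:R + 1 / 2) * x) + sin (x / 2).
Proof.
rewrite /dirichlet_cos mulr_sumr.
elim: n => [|n IH]; rewrite big_nat_recr //= mul_2sin_half_cos.
  rewrite big_nil !add0r -[RHS]/(_ + _) mulNr sinN opprK.
  by rewrite (_ : 1 / 2 * x = x / 2)//; ring.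
rewrite IH (_ : n.+1%:R - 1 / 2 = n%:R + 1 / 2 :> R); first by ring.
by rewrite -[n.+1%:R]natr1; lra.
Qed.

(** The [j]-th derivative of the terms of [2 sin (x/2) (D_n x - g x)] other than
    [sin ((n + 1/2) x)]. *)
Definition low_part (R : realType) (m : nat) (eps : 'I_m.+1 -> bool) (j : nat)
    : R -> R :=
  sin_deriv (1 / 2) j -
  \sum_(k < m.+1) (eps k)%:R \*:
     (sin_deriv (k%:R + 1 / 2) j - sin_deriv (k%:R - 1 / 2) j).

Lemma is_derive_low_part (R : realType) (m : nat) (eps : 'I_m.+1 -> bool)
    (j : nat) (x : R) :
  is_derive x 1 (low_part eps j) (low_part eps j.+1 x).
Proof.
rewrite {2}/low_part [X in is_derive _ _ _ X]/= fctE /= fct_sumE.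
apply: is_deriveB; first exact: is_derive_sin_deriv.
apply: is_derive_sum => k; apply: is_deriveZ.
by apply: is_deriveB; exact: is_derive_sin_deriv.
Qed.

Lemma mul_2sin_half_dirichlet_sub (R : realType) (n m : nat)
    (eps : 'I_m.+1 -> bool) (x : R) :
  2 * sin (x / 2) * (dirichlet_cos n x - cos_poly01 eps x) =
  sin ((n%:R + 1 / 2) * x) + low_part eps 0 x.
Proof.
rewrite mulrBr dirichlet_cos_closed -addrA; congr (_ + _).
rewrite /low_part fctE /= fct_sumE sin_deriv0.
congr (sin _ - _); first by ring.
rewrite /cos_poly01 mulr_sumr; apply: eq_bigr => k _.
rewrite mulrCA mul_2sin_half_cos.
by rewrite -!sin_deriv0.
Qed.

(** Each [k] in the support of [eps] brings two sinusoids, and there are at most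
    [d + 1] such [k], however large [m] is. *)
Lemma low_part_le (R : realType) (m : nat) (eps : 'I_m.+1 -> bool) (j : nat)
    (x : R) :
  `|low_part eps j x| <=
  (2 * (cos_deg eps)%:R + 3) * ((cos_deg eps)%:R + 1 / 2) ^+ j.
Proof.
set d := cos_deg eps; set v : R := d%:R + 1 / 2.
have eps_le k : eps k -> (k <= d)%N by exact: leq_bigmax_cond.
have term_le k : `|(eps k)%:R * (sin_deriv (k%:R + 1 / 2) j x -
    sin_deriv (k%:R - 1 / 2) j x)| <= (eps k)%:R * (2 * v ^+ j) :> R.
  case: (boolP (eps k)) => epsk; last by rewrite !mul0r normr0.
  have kd : k%:R <= d%:R :> R by rewrite ler_nat; exact: eps_le.
  have k0 : 0 <= k%:R :> R by [].
  rewrite !mul1r (le_trans (ler_normB _ _))// mulrDl mul1r lerD//;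
    apply: sin_deriv_le; rewrite /v ler_norml; apply/andP; split; lra.
have card_eps : \sum_(k < m.+1) (eps k)%:R <= d.+1%:R :> R.
  rewrite -natr_sum ler_nat -big_mkcond /= sum1_card cardE.
  rewrite -(size_map val) -[leqRHS](size_iota 0); apply: uniq_leq_size.
    by rewrite (map_inj_uniq val_inj) enum_uniq.
  by move=> _ /mapP[k + ->]; rewrite mem_enum mem_iota ltnS => /eps_le.
have v0 : 0 <= v by rewrite /v addr_ge0.
rewrite /low_part fctE /= fct_sumE (le_trans (ler_normB _ _))//.
apply: (@le_trans _ _ (v ^+ j + \sum_(k < m.+1) (eps k)%:R * (2 * v ^+ j))).
  rewrite lerD//.
    by apply: sin_deriv_le; rewrite /v ger0_norm// lerDr.
  by rewrite (le_trans (ler_norm_sum _ _ _))// ler_sum// => k _; exact: term_le.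
rewrite -mulr_suml -{1}[v ^+ j]mul1r mulrA -mulrDl ler_wpM2r ?exprn_ge0//.
by move: card_eps; rewrite -[d.+1%:R]natr1; lra.
Qed.

(** With [s = n^(-alpha/2)] the hypothesis is [d <= n s^2], and the conclusion
    follows from [(1 - s) (2 n s - 1) >= 0]; the second factor is positive
    because [n s >= 1], a consequence of [alpha < 1]. *)
Lemma freq_ratio_le (R : realType) (n d : nat) (alpha : R) :
  (0 < n)%N -> 0 < alpha < 1 -> d%:R <= n%:R `^ (1 - alpha) ->
  d%:R + 1 / 2 <= n%:R `^ (- (alpha / 2)) * (n%:R + 1 / 2) :> R.
Proof.
move=> n0 /andP[a0 a1]; have n0' : n%:R != 0 :> R by rewrite pnatr_eq0 -lt0n.
have n1 : 1 <= n%:R :> R by rewrite ler1n.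
set s := n%:R `^ (- (alpha / 2)).
have -> : n%:R `^ (1 - alpha) = n%:R * (s * s).
  rewrite /s -powRD ?n0' ?implybT// -{2}[n%:R]powRr1//.
  by rewrite -powRD ?n0' ?implybT//; congr (_ `^ _); lra.
have s0 : 0 < s by rewrite powR_gt0// lt_neqAle eq_sym n0' /=.
have s1 : s <= 1.
  by rewrite -[leRHS](powRr0 n%:R) ler_powR//; lra.
have ns1 : 1 <= n%:R * s.
  rewrite /s -{1}[n%:R]powRr1// -powRD ?n0' ?implybT//.
  by rewrite -[leLHS](powRr0 n%:R) ler_powR//; lra.
move=> dn.
have : 0 <= (1 - s) * (2 * (n%:R * s) - 1) by rewrite mulr_ge0//; lra.
by nra.
Qed.

(** The relative size of [low_part] is at most [(2 n + 3) n^(- alpha j / 2)],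
    hence at most [(2 n + 3) n^-5], and [4 (2 n + 3) <= n^5] for [n >= 2]. *)
Lemma low_part_small (R : realType) (n m : nat) (eps : 'I_m.+1 -> bool)
    (alpha : R) (j : nat) (x : R) :
  (1 < n)%N -> 0 < alpha < 1 -> (cos_deg eps)%:R <= n%:R `^ (1 - alpha) ->
  10 / alpha <= j%:R ->
  `|low_part eps j x| <= (n%:R + 1 / 2) ^+ j / 4.
Proof.
move=> n1 a01 dn ja; have /andP[a0 a1] := a01.
have n2 : 2 <= n%:R :> R by rewrite ler_nat.
have n0' : n%:R != 0 :> R by rewrite pnatr_eq0; case: n n1 {dn n2}.
have ratio := freq_ratio_le (ltnW n1) a01 dn.
apply: le_trans (low_part_le eps j x) _.
set d := (cos_deg eps)%:R in dn ratio *.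
have d0 : 0 <= d by [].
have dn' : d <= n%:R.
  apply: (le_trans dn); rewrite -{2}[n%:R]powRr1// ler_powR//; lra.
have pow : (n%:R `^ (- (alpha / 2))) ^+ j <= (n%:R ^+ 5)^-1.
  rewrite -powR_mulrn ?powR_ge0// -powRrM -powR_invn// ler_powR//; first lra.
  move: ja; rewrite ler_pdivrMr//; lra.
apply: (@le_trans _ _
    ((2 * n%:R + 3) * ((n%:R ^+ 5)^-1 * (n%:R + 1 / 2) ^+ j))).
  rewrite ler_pM ?exprn_ge0//; try lra.
  apply: (@le_trans _ _ ((n%:R `^ (- (alpha / 2)) * (n%:R + 1 / 2)) ^+ j)).
    by rewrite lerXn2r ?nnegrE//; lra.
  by rewrite exprMn ler_wpM2r// exprn_ge0//; lra.
rewrite mulrA [leRHS]mulrC ler_wpM2r ?exprn_ge0 ?addr_ge0//.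
have n0 : 0 < n%:R :> R by lra.
rewrite ler_pdivrMr ?exprn_gt0//.
have n4 : 16 <= n%:R ^+ 4 :> R.
  by rewrite (_ : 16 = 2 ^+ 4) ?lerXn2r ?nnegrE//; lra.
rewrite exprS; nra.
Qed.

(** * The zero count *)

Theorem theorem1p4 (R : realType) :
  exists C : R, 0 < C /\
    forall (n : nat) (alpha : R) (m : nat) (eps : 'I_m.+1 -> bool)
      (I : interval R),
      (1 <= n)%N ->
      0 < alpha < 1 ->
      (cos_deg eps)%:R <= n%:R `^ (1 - alpha) ->
      [set` I] `<=` `[C * (alpha * n%:R)^-1, pi]%classic ->
      (num_zeros [set` I]
         (fun x : R => (dirichlet_cos n x - cos_poly01 eps x)%R)
       <= (C * alpha^-1)%:E * (n%:R%:E * lebesgue_measure [set` I] + 1))%E.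
Proof.
(* 36 = 3 * 12: the block length [J + 1] is at most [12 / alpha], and
   [(2 n + 1) |I| + 1 <= 3 (n |I| + 1)]. *)
exists 36; split => // n alpha m eps I n1 a01 dn Isub.
have /andP[a0 a1] := a01.
have pi4 : pi < 4 :> R by have := pihalf_lt2 R; lra.
have n0 : 0 < n%:R :> R by rewrite ltr0n.
have [r r0 Ir] : exists2 r : R, 0 <= r & lebesgue_measure [set` I] = r%:E.
  have Ifin : (lebesgue_measure [set` I] <= (pi : R)%:E)%E.
    apply: (@le_trans _ _ (lebesgue_measure (`[0%R, pi]%classic : set R))).
      apply: le_measure; rewrite ?inE; try exact: measurable_itv.
      move=> x /Isub /=; rewrite !in_itv /= => /andP[lx ->].
      by rewrite andbT (le_trans _ lx)// mulr_ge0// invr_ge0 mulr_ge0// ltW.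
    by rewrite lebesgue_measure_itv /= lte_fin pi_gt0 -EFinB subr0.
  have Ige0 : (0 <= lebesgue_measure [set` I])%E by [].
  exists (fine (lebesgue_measure [set` I])); first by rewrite fine_ge0.
  by rewrite fineK// ge0_fin_numE// (le_lt_trans Ifin)// ltry.
rewrite Ir -EFinM /num_zeros; apply: counting_le => s us sI.
have rhs0 : 0 <= 36 * alpha^-1 * (n%:R * r + 1).
  by rewrite mulr_ge0// ?mulr_ge0 ?invr_ge0 ?addr_ge0 ?mulr_ge0// ltW.
(* For [n = 1] the function may vanish identically, as for [g = 1 + cos x];
   but then [I] is empty, because [36 / alpha > pi]. *)
have {n1} [n1|n1] : (n = 1 \/ 1 < n)%N.
  by case: n n1 {Isub dn n0 sI rhs0} => [|[|]]; auto.
  case: s {us} sI => [//|y s] sI.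
  have [/Isub /=] := sI _ (mem_head _ _).
  rewrite in_itv /= n1 mulr1 => /andP[ay].
  have : 36 <= 36 * alpha^-1 :> R by rewrite ler_peMr// invf_ge1// ltW.
  lra.
set J := (Num.truncn (10 / alpha)).+1.
have J1 : 10 / alpha <= J%:R by rewrite ltW// truncnS_gt.
have J2 : J%:R <= 11 / alpha.
  rewrite /J -natr1 (_ : 11 / alpha = 10 / alpha + alpha^-1);
    last by field; lra.
  rewrite lerD ?truncn_le//; last by rewrite invf_ge1// ltW.
  by rewrite divr_ge0// ltW.
pose w : R := n%:R + 1 / 2.
pose P (x : R) := [set` I] x /\
  dirichlet_cos n x - cos_poly01 eps x = 0.
have window x t : path <%R x t -> (forall y, y \in x :: t -> P y) ->
    size t = J.+1 -> (2 * w)^-1 <= last x t - x.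
  move=> xt tP tJ.
  apply: (perturbed_sin_zeros_spread (h := low_part eps)) xt _ tJ.
  - by rewrite /w; lra.
  - exact: is_derive_low_part.
  - move=> j y Jj; apply: (low_part_small (alpha := alpha)) => //.
    by rewrite (le_trans J1)// ler_nat.
  - by move=> y /tP[_ fy]; rewrite -mul_2sin_half_dirichlet_sub fy mulr0.
have sorted_s : sorted <%R (sort <=%R s).
  by rewrite sort_lt_sorted.
have {}sI y : y \in sort <=%R s -> P y by rewrite mem_sort => /sI.
rewrite -(size_sort <=%R s).
case: (sort _ _) sorted_s sI => [//|x t] /= xt tP.
have w0 : 0 < (2 * w)^-1 by rewrite invr_gt0 /w; lra.
apply: (le_trans (size_sparse _ w0 window xt tP)) => //.
have span : last x t - x <= r.
  rewrite -lee_fin -Ir; apply: lebesgue_measure_itv_ge.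
    by have [] := tP _ (mem_head _ _).
  by have [] := tP _ (mem_last x t).
have n2 : 2 <= n%:R :> R by rewrite ler_nat.
apply: (@le_trans _ _ (12 / alpha * (3 * (n%:R * r + 1)))); last by lra.
have ia : 1 <= alpha^-1 by rewrite invf_ge1// ltW.
have step : (last x t - x) / (2 * w)^-1 + 1 <= 3 * (n%:R * r + 1).
  rewrite invrK.
  have : (last x t - x) * (2 * w) <= r * (2 * w).
    by rewrite ler_wpM2r// -invr_ge0 ltW.
  have : 0 <= r * (n%:R - 1) by rewrite mulr_ge0//; lra.
  rewrite /w; nra.
have span0 : 0 <= (last x t - x) / (2 * w)^-1 + 1.
  rewrite addr_ge0// divr_ge0 ?(ltW w0)// subr_ge0.
  have := mem_last x t; rewrite inE => /predU1P[->//|lt].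
  by move/(order_path_min lt_trans)/allP: xt => /(_ _ lt)/ltW.
rewrite ler_pM//; rewrite -natr1; lra.
Qed.
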